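(* Let $\mathcal{A}$ be any first-order structure with universe $U_{\mathcal{A}}$ and let $Q=U_{\mathcal{A}}^\infty$. Then $(\mathrm{SDEC}_{\mathcal{A}}^\nu)^Q=\mathrm{SDEC}_{\mathcal{A}}^{\mathrm{ND}}$.
   Context: A first-order structure $\mathcal{A}=(U_{\mathcal{A}};(c_i)_{i};(f_i)_{i};(r_i)_{i})$ has a universe, constants, functions $f_i$ of arity $m_i$ and relations $r_i$ of arity $k_i$ (the identity relation need not be among them). $U_{\mathcal{A}}^\infty=\bigcup_{n\ge1}U_{\mathcal{A}}^n$. A (deterministic) BSS RAM $\mathcal{M}$ over $\mathcal{A}$ has $Z$-registers $Z_1,Z_2,\dots$ (holding elements of $U_{\mathcal{A}}$), finitely many index registers $I_1,\dots,I_{k}$ (holding positive integers), and a program: a finite sequence of labeled instructions $1,\dots,\ell_{\mathcal P}$, the last being the only stop instruction, each of one of the types: $Z_j:=f_i(Z_{j_1},\dots,Z_{j_{m_i}})$; $Z_j:=c_i$; $Z_{I_j}:=Z_{I_k}$; if $r_i(Z_{j_1},\dots,Z_{j_{k_i}})$ then goto $\ell_1$ else goto $\ell_2$; if $I_j=I_k$ then goto $\ell_1$ else goto $\ell_2$; $I_j:=1$; $I_j:=I_j+1$; stop. A configuration is $(\ell,\nu_1,\dots,\nu_k,u_1,u_2,\dots)$, transformed step by step in the obvious way. On input $\vec x=(x_1,\dots,x_n)$ the initial configuration is $(1,(n,1,\dots,1),(x_1,\dots,x_n,x_n,x_n,\dots))$; at the stop label the output is $(u_1,\dots,u_{\nu_1})$.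 The halting set of a machine is the set of inputs with at least one halting computation. A non-deterministic BSS RAM over $\mathcal{A}$ is like a deterministic one except that on input $\vec x$ every configuration $(1,(n,1,\dots,1),(x_1,\dots,x_n,y_1,\dots,y_m,x_n,x_n,\dots))$ with $m\ge1$ and arbitrary guesses $(y_1,\dots,y_m)\in U_{\mathcal{A}}^m$ is an admissible initial configuration. $\mathrm{SDEC}_{\mathcal{A}}^{\mathrm{ND}}$ is the class of halting sets of such machines. For $Q\subseteq U_{\mathcal{A}}^\infty$ and $\vec z\in U_{\mathcal{A}}^\infty$, $\nu[Q](\vec z)=\{y_1\in U_{\mathcal{A}}\mid \exists m\ge1\ \exists y_2,\dots,y_m:\ (\vec z,y_1,\dots,y_m)\in Q\}$. A $\nu$-oracle BSS RAM over $\mathcal{A}$ with oracle $Q$ is a BSS RAM (deterministic input procedure) that may additionally use instructions $Z_j:=\nu[Q](Z_1,\dots,Z_{I_1})$, which set $Z_j$ to an arbitrarily chosen element of $\nu[Q](u_1,\dots,u_{\nu_1})$ (current contents of $Z_1,\dots,Z_{\nu_1}$, $\nu_1$ the content of $I_1$), and loop forever if this set is empty. $(\mathrm{SDEC}_{\mathcal{A}}^\nu)^Q$ is the class of halting sets of $\nu$-oracle BSS RAMs over $\mathcal{A}$ with oracle $Q$. *)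

(* Defs.v *)
From Stdlib Require Import List Arith PeanoNat.
From Stdlib Require Fin.
Import ListNotations.
Set Implicit Arguments.

(** * First-order structures
    A structure has a universe [U], a family of constants, a family of
    functions (with arities) and a family of relations (with arities).
    Arguments of an arity-[m] function/relation are given as a map
    [Fin.t m -> U]. The identity relation is not required to be present. *)
Record structure : Type := {
  U : Type;
  cidx : Type;
  cst : cidx -> U;
  fidx : Type;
  farity : fidx -> nat;
  fn : forall i : fidx, (Fin.t (farity i) -> U) -> U;
  ridx : Type;
  rarity : ridx -> nat;
  rel : forall i : ridx, (Fin.t (rarity i) -> U) -> Prop
}.

(** Elements of U^infty are the non-empty lists over U. *)

(** * Instructions (register numbers and labels are 1-based, as in the paper)
  - [IFun j i args]     : Z_j := f_i(Z_{args 1}, ..., Z_{args m_i})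
  - [IConst j i]        : Z_j := c_i
  - [ICopy j k]         : Z_{I_j} := Z_{I_k}
  - [IRel i args l1 l2] : if r_i(Z_{args ..}) then goto l1 else goto l2
  - [IIdxEq j k l1 l2]  : if I_j = I_k then goto l1 else goto l2
  - [IIdxSet1 j]        : I_j := 1
  - [IIdxInc j]         : I_j := I_j + 1
  - [IStop]             : stop
  - [IOracle j]         : Z_j := nu[Q](Z_1, ..., Z_{I_1})   (oracle machines only) *)
Inductive instr (A : structure) : Type :=
| IFun (j : nat) (i : fidx A) (args : Fin.t (farity A i) -> nat)
| IConst (j : nat) (i : cidx A)
| ICopy (j k : nat)
| IRel (i : ridx A) (args : Fin.t (rarity A i) -> nat) (l1 l2 : nat)
| IIdxEq (j k l1 l2 : nat)
| IIdxSet1 (j : nat)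
| IIdxInc (j : nat)
| IStop
| IOracle (j : nat).

Arguments IFun {A}. Arguments IConst {A}. Arguments ICopy {A}. Arguments IRel {A}.
Arguments IIdxEq {A}. Arguments IIdxSet1 {A}. Arguments IIdxInc {A}. Arguments IStop {A}. Arguments IOracle {A}.

(** A machine: number k of index registers and a program (labels 1..length). *)
Record machine (A : structure) : Type := {
  nidx : nat;
  prog : list (instr A)
}.

Definition zreg_ok (j : nat) : Prop := 1 <= j.
Definition ireg_ok {A : structure} (M : machine A) (j : nat) : Prop :=
  1 <= j <= nidx M.
Definition label_ok {A : structure} (M : machine A) (l : nat) : Prop :=
  1 <= l <= length (prog M).

Definition instr_ok {A : structure} (M : machine A) (ins : instr A) : Prop :=
  match ins with
  | IFun j i args => zreg_ok j /\ forall t, zreg_ok (args t)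
  | IConst j _ => zreg_ok j
  | ICopy j k => ireg_ok M j /\ ireg_ok M k
  | IRel i args l1 l2 => (forall t, zreg_ok (args t)) /\ label_ok M l1 /\ label_ok M l2
  | IIdxEq j k l1 l2 => ireg_ok M j /\ ireg_ok M k /\ label_ok M l1 /\ label_ok M l2
  | IIdxSet1 j => ireg_ok M j
  | IIdxInc j => ireg_ok M j
  | IStop => True
  | IOracle j => zreg_ok j
  end.

Definition is_stop {A : structure} (ins : instr A) : Prop :=
  match ins with IStop => True | _ => False end.

(** Well-formed machine: at least one index register (I_1 is used for input
    length), nonempty program whose last instruction is the only stop
    instruction, and all register / label references are in range. *)
Definition wf_machine {A : structure} (M : machine A) : Prop :=
  1 <= nidx M /\
  prog M <> [] /\
  (forall n ins, nth_error (prog M) n = Some ins ->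
     instr_ok M ins /\ (is_stop ins <-> n = length (prog M) - 1)).

Definition no_oracle {A : structure} (M : machine A) : Prop :=
  forall n j, nth_error (prog M) n <> Some (IOracle j).

Record config (A : structure) : Type := mkConfig {
  lab : nat;
  idx : nat -> nat;   (* I_j at position j *)
  reg : nat -> U A    (* Z_j at position j (position 0 unused) *)
}.

Arguments mkConfig {A}.

Definition fupd {T : Type} (f : nat -> T) (j : nat) (v : T) : nat -> T :=
  fun x => if Nat.eqb x j then v else f x.

Definition nu {A : structure} (Q : list (U A) -> Prop) (z : list (U A)) (y1 : U A) : Prop :=
  exists ys : list (U A), Q (z ++ y1 :: ys).

Definition query {A : structure} (c : config A) : list (U A) :=
  map (reg c) (seq 1 (idx c 1)).

(** One computation step of machine [M] with oracle [Q]
    (the oracle is irrelevant for machines without oracle instructions). *)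
Definition step {A : structure} (Q : list (U A) -> Prop) (M : machine A)
    (c c' : config A) : Prop :=
  match nth_error (prog M) (lab c - 1) with
  | Some (IFun j i args) =>
      c' = mkConfig (S (lab c)) (idx c) (fupd (reg c) j (fn A i (fun t => reg c (args t))))
  | Some (IConst j i) =>
      c' = mkConfig (S (lab c)) (idx c) (fupd (reg c) j (cst A i))
  | Some (ICopy j k) =>
      c' = mkConfig (S (lab c)) (idx c) (fupd (reg c) (idx c j) (reg c (idx c k)))
  | Some (IRel i args l1 l2) =>
      (rel A i (fun t => reg c (args t)) /\ c' = mkConfig l1 (idx c) (reg c)) \/
      (~ rel A i (fun t => reg c (args t)) /\ c' = mkConfig l2 (idx c) (reg c))
  | Some (IIdxEq j k l1 l2) =>
      (idx c j = idx c k /\ c' = mkConfig l1 (idx c) (reg c)) \/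
      (idx c j <> idx c k /\ c' = mkConfig l2 (idx c) (reg c))
  | Some (IIdxSet1 j) =>
      c' = mkConfig (S (lab c)) (fupd (idx c) j 1) (reg c)
  | Some (IIdxInc j) =>
      c' = mkConfig (S (lab c)) (fupd (idx c) j (S (idx c j))) (reg c)
  | Some (IOracle j) =>
      (* choose an arbitrary element of nu[Q](query); loop forever if empty *)
      (exists y, nu Q (query c) y /\ c' = mkConfig (S (lab c)) (idx c) (fupd (reg c) j y)) \/
      ((forall y, ~ nu Q (query c) y) /\ c' = c)
  | Some IStop => False
  | None => False
  end.

Inductive reach {A : structure} (Q : list (U A) -> Prop) (M : machine A)
  : config A -> config A -> Prop :=
| reach_refl : forall c, reach Q M c c
| reach_step : forall c c' c'', step Q M c c' -> reach Q M c' c'' -> reach Q M c c''.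

(** Initial configuration (1, (n,1,...,1), (w_1, ..., w_p, x_n, x_n, ...))
    where w = x ++ ys, n = length x, and [xn] is the last entry of x. *)
Definition init_config {A : structure} (x ys : list (U A)) (xn : U A) : config A :=
  mkConfig 1 (fun j => if Nat.eqb j 1 then length x else 1)
           (fun i => nth (pred i) (x ++ ys) xn).

Definition halted {A : structure} (M : machine A) (c : config A) : Prop :=
  lab c = length (prog M).

Definition halts_det {A : structure} (Q : list (U A) -> Prop) (M : machine A)
    (x : list (U A)) : Prop :=
  exists (a : U A) (r : list (U A)) (c' : config A),
    x = a :: r /\ reach Q M (init_config x [] (last x a)) c' /\ halted M c'.

(** Halting set of a non-deterministic machine: some guesses (y_1..y_m), m >= 1,
    give a halting computation from (1,(n,1,..,1),(x_1..x_n,y_1..y_m,x_n,x_n,..)). *)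
Definition halts_ND {A : structure} (M : machine A) (x : list (U A)) : Prop :=
  exists (a : U A) (r ys : list (U A)) (c' : config A),
    x = a :: r /\ ys <> [] /\
    reach (fun _ => False) M (init_config x ys (last x a)) c' /\ halted M c'.

Definition SDEC_ND (A : structure) (P : list (U A) -> Prop) : Prop :=
  exists M : machine A, wf_machine M /\ no_oracle M /\
    forall x, P x <-> halts_ND M x.

Definition SDEC_nu (A : structure) (Q : list (U A) -> Prop) (P : list (U A) -> Prop) : Prop :=
  exists M : machine A, wf_machine M /\
    forall x, P x <-> halts_det Q M x.

Definition Uinf (A : structure) : list (U A) -> Prop := fun l => l <> [].

(* Main.v *)
(** Both inclusions use the same simulation. The simulating machine keeps the
    registers of the simulated one in place, but only up to a frontier, and
    advances the frontier by one position before every simulated instruction.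
    Index registers grow by at most one per step, so the simulated machine never
    looks beyond the frontier.

    A guessing machine simulating an oracle machine finds unused guesses beyond
    the frontier. It overwrites the first one by the last input entry when the
    frontier advances, and answers a query by the next one. An oracle machine
    simulating a guessing machine fills the new register at the frontier with an
    oracle answer, so the guesses are made only when they become visible; a
    halting computation uses finitely many of them. In both cases control flow
    cannot depend on the number of guesses, which is why the guesses are consumed
    at a fixed rate, one per step. *)

From Stdlib Require Import List Arith PeanoNat Lia Classical FunctionalExtensionality.
From Stdlib Require Fin.
Require Import Defs.
Import ListNotations.
Set Implicit Arguments.
Set Default Proof Using "Type".

(** * Runs of counted length and their deterministic segments *)

Inductive nsteps {T : Type} (R : T -> T -> Prop) : nat -> T -> T -> Prop :=
| nsteps_0 : forall c, nsteps R 0 c c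
| nsteps_S : forall n c c1 c2, R c c1 -> nsteps R n c1 c2 -> nsteps R (S n) c c2.

Lemma nsteps_trans {T : Type} (R : T -> T -> Prop) n m a b c :
  nsteps R n a b -> nsteps R m b c -> nsteps R (n + m) a c.
Proof. induction 1; simpl; intros; eauto using nsteps_S. Qed.

Lemma nsteps_one {T : Type} (R : T -> T -> Prop) a b : R a b -> nsteps R 1 a b.
Proof. eauto using nsteps_0, nsteps_S. Qed.

Lemma nsteps_mono {T : Type} (R R' : T -> T -> Prop) n a b :
  (forall a b, R a b -> R' a b) -> nsteps R n a b -> nsteps R' n a b.
Proof. intros H; induction 1; eauto using nsteps_0, nsteps_S. Qed.

Lemma reach_nsteps {A : structure} (Q : list (U A) -> Prop) (M : machine A) c d :
  reach Q M c d <-> exists n, nsteps (step Q M) n c d.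
Proof.
  split.
  - induction 1 as [|c c1 d s _ [n IH]]; eauto using nsteps_0, nsteps_S.
  - intros [n H]; induction H; eauto using reach_refl, reach_step.
Qed.

(** Away from oracle instructions the successor is unique. Compiled code contains no oracle
    instruction except the query inside [eat_answer], so an arbitrary run can be traced through
    everything else. *)
Definition dstep {A : structure} (Q : list (U A) -> Prop) (M : machine A)
    (c c' : config A) : Prop :=
  step Q M c c' /\ forall j, nth_error (prog M) (lab c - 1) <> Some (IOracle j).

Lemma dstep_step {A : structure} (Q : list (U A) -> Prop) (M : machine A) c d :
  dstep Q M c d -> step Q M c d.
Proof. intros [H _]; exact H. Qed.

Lemma dsteps_steps {A : structure} (Q : list (U A) -> Prop) (M : machine A) n c d :
  nsteps (dstep Q M) n c d -> nsteps (step Q M) n c d.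
Proof. apply nsteps_mono, dstep_step. Qed.

Lemma dstep_det {A : structure} (Q : list (U A) -> Prop) (M : machine A) c d d' :
  dstep Q M c d -> step Q M c d' -> d = d'.
Proof.
  unfold dstep, step; intros [H Ho] H'.
  destruct (nth_error _ _) as [[]|]; try congruence; try tauto.
  - destruct H as [[? ->]|[? ->]], H' as [[? ->]|[? ->]]; tauto.
  - destruct H as [[? ->]|[? ->]], H' as [[? ->]|[? ->]]; tauto.
  - now destruct (Ho j).
Qed.

Definition nonstop {A : structure} (ins : instr A) : Prop := ~ is_stop ins.

(** A concatenation of translated blocks has the shape [front ++ [IStop]], so in this form
    well-formedness of a compiled program splits into facts about its pieces. *)
Lemma wf_machine_alt {A : structure} (M : machine A) :
  wf_machine M <->
  1 <= nidx M /\ Forall (instr_ok M) (prog M) /\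
  exists front, prog M = front ++ [IStop] /\ Forall nonstop front.
Proof.
  split.
  - intros (Hk & Hne & H); split; [exact Hk|].
    destruct (exists_last Hne) as (front & ins & Hp).
    split; [|exists front; split].
    + apply Forall_forall; intros i Hi; apply In_nth_error in Hi as [n Hn].
      apply (H n i Hn).
    + rewrite Hp; do 2 f_equal.
      destruct (H (length front) ins) as [_ Hs].
      { rewrite Hp, nth_error_app2, Nat.sub_diag; auto. }
      destruct ins; trivial; exfalso; apply Hs;
        rewrite Hp, length_app; simpl; lia.
    + apply Forall_forall; intros i Hi Hs; apply In_nth_error in Hi as [n Hn].
      assert (n < length front) by (apply nth_error_Some; congruence).
      destruct (H n i) as [_ Hst]; [rewrite Hp, nth_error_app1; auto|].
      apply Hst in Hs; rewrite Hp, length_app in Hs; simpl in Hs; lia.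
  - intros (Hk & Hok & front & Hp & Hns); split; [exact Hk|split].
    + rewrite Hp; destruct front; discriminate.
    + intros n ins Hn; split.
      * rewrite Forall_forall in Hok; eauto using nth_error_In.
      * rewrite Hp in *; rewrite length_app; simpl.
        destruct (Nat.lt_ge_cases n (length front)) as [Hlt|Hge].
        -- rewrite nth_error_app1 in Hn by assumption.
           rewrite Forall_forall in Hns.
           specialize (Hns _ (nth_error_In _ _ Hn)); unfold nonstop in Hns.
           split; [tauto|lia].
        -- assert (n < length (front ++ [IStop])) by (apply nth_error_Some; congruence).
           rewrite length_app in *; simpl in *.
           assert (n = length front) as -> by lia.
           rewrite nth_error_app2, Nat.sub_diag in Hn by lia; injection Hn as <-.
           simpl; split; [lia|tauto].
Qed.

Lemma nth_error_stop {A : structure} (M : machine A) :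
  wf_machine M -> nth_error (prog M) (length (prog M) - 1) = Some IStop.
Proof.
  intros H; apply wf_machine_alt in H as (_ & _ & front & -> & _).
  rewrite length_app, nth_error_app2; simpl; [|lia].
  now replace (_ - _) with 0 by lia.
Qed.

Lemma halted_no_step {A : structure} (Q : list (U A) -> Prop) (M : machine A) c d :
  wf_machine M -> halted M c -> ~ step Q M c d.
Proof.
  unfold halted, step; intros Hw ->; now rewrite nth_error_stop.
Qed.

Lemma nsteps_head {A : structure} (Q : list (U A) -> Prop) (M : machine A) n c d e :
  wf_machine M -> step Q M c d -> nsteps (step Q M) n c e -> halted M e ->
  exists c1 n', n = S n' /\ step Q M c c1 /\ nsteps (step Q M) n' c1 e.
Proof.
  intros Hw Hd Hn He; destruct Hn as [c|n c c1 e Hs Hn]; [|eauto].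
  exfalso; eapply halted_no_step; eauto.
Qed.

(** A halting run cannot end inside the segment, because the stop label has no successor, and cannot
    leave it, by determinism. The number of remaining steps is exposed for induction on the length
    of a simulating run. *)
Lemma dsteps_cut {A : structure} (Q : list (U A) -> Prop) (M : machine A) m n c d e :
  wf_machine M -> nsteps (dstep Q M) m c d -> nsteps (step Q M) n c e -> halted M e ->
  exists n', n = m + n' /\ nsteps (step Q M) n' d e.
Proof.
  intros Hw H; revert n; induction H as [c|m c c1 d Hs _ IH]; intros n Hr He.
  - exists n; auto.
  - destruct (nsteps_head _ Hw (dstep_step Hs) Hr He) as (c2 & n1 & -> & Hs' & Hr').
    rewrite <- (dstep_det _ Hs Hs') in Hr'.
    destruct (IH _ Hr' He) as (n' & -> & H'); exists n'; auto.
Qed.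

Lemma fupd_eq {T : Type} (f : nat -> T) j v : fupd f j v j = v.
Proof. unfold fupd; now rewrite Nat.eqb_refl. Qed.

Lemma fupd_neq {T : Type} (f : nat -> T) j v i : i <> j -> fupd f j v i = f i.
Proof. unfold fupd; intros H; now rewrite (proj2 (Nat.eqb_neq _ _) H). Qed.

Lemma fupd_agree {T : Type} (f g : nat -> T) j v w i :
  v = w -> (i <> j -> f i = g i) -> fupd f j v i = fupd g j w i.
Proof.
  intros -> H; unfold fupd; destruct (Nat.eqb_spec i j); auto.
Qed.

(** * Code fragments and their effects *)

Definition code_at {A : structure} (M : machine A) (l : nat) (code : list (instr A)) : Prop :=
  forall i ins, nth_error code i = Some ins -> nth_error (prog M) (l - 1 + i) = Some ins.

Lemma code_at_cons {A : structure} (M : machine A) l ins code :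
  1 <= l -> code_at M l (ins :: code) ->
  nth_error (prog M) (l - 1) = Some ins /\ code_at M (S l) code.
Proof.
  intros Hl H; split.
  - rewrite <- (H 0 ins eq_refl); f_equal; lia.
  - intros i ins' Hi; rewrite <- (H (S i) ins' Hi); f_equal; lia.
Qed.

Lemma code_at_app {A : structure} (M : machine A) l c1 c2 :
  1 <= l -> code_at M l (c1 ++ c2) -> code_at M l c1 /\ code_at M (l + length c1) c2.
Proof.
  intros Hl H; split; intros i ins Hi.
  - apply H; rewrite nth_error_app1; trivial; apply nth_error_Some; congruence.
  - rewrite <- (H (length c1 + i) ins).
    + f_equal; lia.
    + rewrite nth_error_app2 by lia; rewrite <- Hi; f_equal; lia.
Qed.

Definition copy_eff {A : structure} (j k : nat) (c : config A) : config A :=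
  mkConfig (S (lab c)) (idx c) (fupd (reg c) (idx c j) (reg c (idx c k))).

Definition inc_eff {A : structure} (j : nat) (c : config A) : config A :=
  mkConfig (S (lab c)) (fupd (idx c) j (S (idx c j))) (reg c).

Lemma copy_dstep {A : structure} (Q : list (U A) -> Prop) (M : machine A) c j k :
  nth_error (prog M) (lab c - 1) = Some (ICopy j k) -> dstep Q M c (copy_eff j k c).
Proof. intros H; unfold dstep, step; rewrite H; split; [reflexivity|discriminate]. Qed.

Lemma inc_dstep {A : structure} (Q : list (U A) -> Prop) (M : machine A) c j :
  nth_error (prog M) (lab c - 1) = Some (IIdxInc j) -> dstep Q M c (inc_eff j c).
Proof. intros H; unfold dstep, step; rewrite H; split; [reflexivity|discriminate]. Qed.

Lemma incs_dsteps {A : structure} (Q : list (U A) -> Prop) (M : machine A) rs :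
  forall c, 1 <= lab c -> code_at M (lab c) (map IIdxInc rs) ->
  exists d, nsteps (dstep Q M) (length rs) c d /\ lab d = lab c + length rs /\
    reg d = reg c /\ forall r, idx d r = idx c r + count_occ Nat.eq_dec rs r.
Proof.
  induction rs as [|r rs IH]; simpl; intros c Hl Hc.
  - exists c; repeat split; auto using nsteps_0; lia.
  - apply code_at_cons in Hc as [H0 Hc]; trivial.
    destruct (IH (inc_eff r c)) as (d & Hd & Hld & Hrd & Hid); simpl; trivial; [lia|].
    exists d; split; [|split; [|split]].
    + eapply nsteps_S; eauto using inc_dstep.
    + simpl in Hld; lia.
    + exact Hrd.
    + intros r'; rewrite Hid; simpl.
      destruct (Nat.eq_dec r r') as [->|Hne].
      * rewrite fupd_eq; lia.
      * rewrite fupd_neq by auto; lia.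
Qed.

(** * Bounding the directly addressed registers *)

Definition zreg_le {A : structure} (J : nat) (ins : instr A) : Prop :=
  match ins with
  | IFun j i args => j <= J /\ forall t, args t <= J
  | IConst j _ => j <= J
  | IRel i args _ _ => forall t, args t <= J
  | IOracle j => j <= J
  | _ => True
  end.

Lemma Fin_bounded m (f : Fin.t m -> nat) : exists B, forall t, f t <= B.
Proof.
  induction m as [|m IH].
  - exists 0; intros t; inversion t.
  - destruct (IH (fun t => f (Fin.FS t))) as [B HB].
    exists (max B (f Fin.F1)); intros t; apply (Fin.caseS' t).
    + lia.
    + intros t'; specialize (HB t'); simpl in HB; lia.
Qed.

Lemma zreg_le_mono {A : structure} J J' (ins : instr A) :
  J <= J' -> zreg_le J ins -> zreg_le J' ins.
Proof.
  intros HJ; destruct ins; simpl; try lia.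
  - intros [H1 H2]; split; [lia|]; intros t; specialize (H2 t); lia.
  - intros H t; specialize (H t); lia.
Qed.

(** A program names finitely many [Z]-registers by number; all others are reached through index
    registers, whose contents are bounded separately in [sim]. The condition [1 <= J] provides the
    register [pointer k 1] used by [eat_answer]. *)
Lemma zreg_bounded {A : structure} (p : list (instr A)) :
  exists J, 1 <= J /\ Forall (zreg_le J) p.
Proof.
  induction p as [|ins p [J [HJ IH]]]; [exists 1; auto|].
  assert (exists B, zreg_le B ins) as [B HB].
  { destruct ins; simpl; try (exists 0; exact I); try (exists j; lia).
    - destruct (Fin_bounded args) as [B HB]; exists (max B j); split; [lia|].
      intros t; specialize (HB t); lia.
    - apply Fin_bounded. }
  exists (max B J); split; [lia|].
  constructor; [eapply zreg_le_mono; [|exact HB]; lia|].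
  eapply Forall_impl; [|exact IH]; intros a; apply zreg_le_mono; lia.
Qed.

(** * Programs made of blocks of equal length *)

Lemma nth_error_flat_map_const {S T : Type} (f : S -> list T) b l :
  (forall s, length (f s) = b) -> forall q s i,
  nth_error l q = Some s -> i < b ->
  nth_error (flat_map f l) (b * q + i) = nth_error (f s) i.
Proof.
  intros Hb; induction l as [|s0 l IH]; intros [|q] s i Hq Hi; try discriminate; simpl.
  - injection Hq as ->; rewrite Nat.mul_0_r; apply nth_error_app1; rewrite Hb; trivial.
  - rewrite nth_error_app2 by (rewrite Hb; nia).
    rewrite <- (IH q s i Hq Hi); f_equal; rewrite Hb; nia.
Qed.

Lemma length_flat_map_const {S T : Type} (f : S -> list T) b l :
  (forall s, length (f s) = b) -> length (flat_map f l) = b * length l.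
Proof.
  intros Hb; induction l as [|s l IH]; simpl; [lia|].
  rewrite length_app, Hb, IH; lia.
Qed.

(** A common form for the steps of both kinds of simulated machine, with the oracle answer
    prescribed. For the oracle [Uinf] every element is a legal answer, and a machine without oracle
    instructions ignores [y]; one simulation lemma therefore serves both inclusions. *)
Definition step_with {A : structure} (M : machine A) (y : U A) (c c' : config A) : Prop :=
  match nth_error (prog M) (lab c - 1) with
  | Some (IOracle j) => c' = mkConfig (S (lab c)) (idx c) (fupd (reg c) j y)
  | _ => step (Uinf A) M c c'
  end.

Lemma step_with_progress {A : structure} (M : machine A) y c :
  wf_machine M -> 1 <= lab c <= length (prog M) -> ~ halted M c -> exists c1, step_with M y c c1.
Proof.
  unfold halted, step_with, step; intros wfM Hl Hh.
  destruct (nth_error _ _) as [ins|] eqn:Hn.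
  - destruct ins; eauto.
    + destruct (classic (rel A i (fun t => reg c (args t)))); eauto.
    + destruct (Nat.eq_dec (idx c j) (idx c k)); eauto.
    + exfalso; apply wfM in Hn as [_ Hn]; simpl in Hn; intuition lia.
  - apply nth_error_None in Hn; lia.
Qed.

(** * The simulating machine *)

(** Index registers beyond the [k] simulated ones. Two hold the frontier and its successor;
    [pointer k j] permanently holds [j], since the only copy instruction takes both of its addresses
    from index registers. *)
Definition frontier (k : nat) : nat := S k.
Definition above (k : nat) : nat := S (S k).
Definition pointer (k j : nat) : nat := S (S k) + j.

(* A loop setting [I_frontier] to the input length [n] and [I_above] to [n + 1]. *)
Definition header {A : structure} (k : nat) : list (instr A) :=
  [IIdxInc (above k); IIdxEq 1 (frontier k) 6 3; IIdxInc (frontier k);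
   IIdxInc (above k); IIdxEq 1 1 2 2].

(** Every index register other than the first starts at 1, whence [j - 1] increments. *)
Definition pointer_incs (k J : nat) : list nat :=
  flat_map (fun j => repeat (pointer k j) (j - 1)) (seq 1 J).

(** The [J] final advances bring all directly addressed registers below the frontier before the
    simulation begins. *)
Definition preamble {A : structure} (k J : nat) (eat : list (instr A)) : list (instr A) :=
  header k ++ map IIdxInc (pointer_incs k J) ++ flat_map (fun _ => eat) (seq 1 J).

(** Jumps lead to the [eat] that opens a block, so each simulated instruction is preceded by one
    advance of the frontier, whatever the control flow. *)
Definition new_label {A : structure} (k J : nat) (eat : list (instr A)) (l : nat) : nat :=
  length (preamble k J eat) + S (length eat) * (l - 1) + 1.

Definition translate {A : structure} (k J : nat) (eat : list (instr A)) (ins : instr A)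
  : instr A :=
  match ins with
  | IRel i args l1 l2 => IRel i args (new_label k J eat l1) (new_label k J eat l2)
  | IIdxEq j j' l1 l2 => IIdxEq j j' (new_label k J eat l1) (new_label k J eat l2)
  | IOracle j => ICopy (pointer k j) (above k)
  | _ => ins
  end.

Definition compile {A : structure} (M : machine A) (J : nat) (eat : list (instr A))
  : machine A :=
  {| nidx := nidx M + 2 + J;
     prog := preamble (nidx M) J eat ++
       flat_map (fun ins => eat ++ [translate (nidx M) J eat ins]) (prog M) |}.

Lemma count_pointer_incs k J r :
  count_occ Nat.eq_dec (pointer_incs k J) r =
  if andb (above k <? r) (r <=? above k + J) then r - above k - 1 else 0.
Proof.
  unfold pointer_incs, pointer, above; induction J as [|J IH].
  - simpl; destruct (Nat.ltb_spec (S (S k)) r), (Nat.leb_spec r (S (S (k + 0)))); simpl; lia.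
  - rewrite seq_S, flat_map_app, count_occ_app, IH; simpl; rewrite app_nil_r.
    destruct (Nat.eq_dec r (S (S (k + S J)))) as [->|Hne].
    + rewrite count_occ_repeat_eq by trivial.
      destruct (Nat.ltb_spec (S (S k)) (S (S (k + S J)))),
        (Nat.leb_spec (S (S (k + S J))) (S (S (k + J)))),
        (Nat.leb_spec (S (S (k + S J))) (S (S (k + S J)))); simpl; lia.
    + rewrite count_occ_repeat_neq by auto.
      destruct (Nat.ltb_spec (S (S k)) r), (Nat.leb_spec r (S (S (k + J)))),
        (Nat.leb_spec r (S (S (k + S J)))); simpl; lia.
Qed.

(** * Correctness of the compiled program *)

Section Compile.
Variables (A : structure) (M : machine A) (J : nat) (eat : list (instr A)).
Hypothesis wfM : wf_machine M.
Hypothesis J_bound : Forall (zreg_le J) (prog M).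

Let k := nidx M.
Let M' := compile M J eat.
Let E := length eat.
Let start := 5 + length (pointer_incs k J).

Lemma prog_compile : prog M' = preamble k J eat ++
  flat_map (fun ins => eat ++ [translate k J eat ins]) (prog M).
Proof. reflexivity. Qed.

Lemma length_block (ins : instr A) : length (eat ++ [translate k J eat ins]) = S E.
Proof. rewrite length_app; simpl; unfold E; lia. Qed.

Lemma length_preamble : length (preamble k J eat) = start + E * J.
Proof.
  unfold preamble; rewrite !length_app, length_map, (length_flat_map_const _ (b := E)) by auto.
  rewrite length_seq; simpl; unfold start; lia.
Qed.

Lemma length_compile : length (prog M') = length (preamble k J eat) + S E * length (prog M).
Proof.
  rewrite prog_compile, length_app.
  rewrite (length_flat_map_const _ (b := S E)); auto using length_block.
Qed.

Lemma header_at : code_at M' 1 (header k ++ map IIdxInc (pointer_incs k J)).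
Proof.
  intros i ins Hi; rewrite prog_compile, Nat.sub_diag; unfold preamble; simpl (0 + i).
  rewrite nth_error_app1.
  - rewrite app_assoc, nth_error_app1; trivial; apply nth_error_Some; congruence.
  - rewrite app_assoc, length_app; apply Nat.lt_lt_add_r, nth_error_Some; congruence.
Qed.

Lemma preamble_eat_at t : t < J -> code_at M' (start + E * t + 1) eat.
Proof.
  intros Ht i ins Hi.
  assert (i < E) by (apply nth_error_Some; congruence).
  rewrite prog_compile, nth_error_app1 by (rewrite length_preamble; nia).
  unfold preamble; rewrite app_assoc, nth_error_app2;
    rewrite length_app, length_map; simpl; [|unfold start; lia].
  replace (_ - _) with (E * t + i) by (unfold start; lia).
  rewrite (@nth_error_flat_map_const _ _ _ E _ (fun _ => eq_refl) t (S t)); auto.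
  rewrite nth_error_seq; destruct (Nat.ltb_spec t J); [reflexivity|lia].
Qed.

Lemma block_at l ins :
  1 <= l -> nth_error (prog M) (l - 1) = Some ins ->
  code_at M' (new_label k J eat l) (eat ++ [translate k J eat ins]).
Proof.
  intros Hl Hn i ins' Hi.
  assert (i < S E) by (rewrite <- (length_block ins); apply nth_error_Some; congruence).
  unfold new_label; rewrite prog_compile, nth_error_app2 by lia; fold E.
  replace (_ - length (preamble k J eat)) with (S E * (l - 1) + i)
    by (generalize (S E * (l - 1)); lia).
  rewrite (@nth_error_flat_map_const _ _ _ (S E) _ length_block (l - 1) ins); auto.
Qed.

Lemma new_label_pos l : 1 <= new_label k J eat l.
Proof. apply Nat.le_add_l. Qed.

Lemma new_label_ok l : label_ok M l -> label_ok M' (new_label k J eat l).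
Proof.
  unfold label_ok; rewrite length_compile; unfold new_label; fold E; nia.
Qed.

Lemma compile_wf :
  Forall (instr_ok M') eat -> Forall nonstop eat -> wf_machine M'.
Proof using wfM J_bound.
  intros Hok Hns; apply wf_machine_alt.
  pose proof (proj1 (wf_machine_alt M) wfM) as (Hk & HokM & front & Hp & Hfr).
  fold k in Hk.
  assert (Hlen : length (prog M') >= 6).
  { rewrite length_compile, length_preamble, Hp, length_app; simpl; unfold start; lia. }
  split; [simpl; lia|split].
  - rewrite prog_compile; unfold preamble; rewrite !Forall_app; repeat split.
    + unfold header; rewrite !Forall_cons_iff; simpl; unfold ireg_ok, label_ok, above, frontier.
      simpl nidx; fold k; intuition (auto; lia).
    + apply Forall_map, Forall_forall; intros r Hr.
      apply in_flat_map in Hr as (j & Hj & Hr); apply in_seq in Hj.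
      apply repeat_spec in Hr; subst r; simpl; unfold ireg_ok, pointer; simpl; fold k; lia.
    + apply Forall_flat_map, Forall_forall; auto.
    + apply Forall_flat_map; rewrite Forall_forall in *; intros ins Hins.
      apply Forall_app; split; [now apply Forall_forall|].
      repeat constructor; specialize (HokM _ Hins); specialize (J_bound _ Hins).
      destruct ins; simpl in *; unfold ireg_ok in *; simpl; fold k in HokM |- *;
        try tauto; try lia.
      * destruct HokM as (? & ? & ?); auto using new_label_ok.
      * destruct HokM as (? & ? & ? & ?); repeat split; try lia;
          apply new_label_ok; assumption.
      * unfold zreg_ok, pointer, above in *; lia.
  - exists (preamble k J eat ++
       flat_map (fun ins => eat ++ [translate k J eat ins]) front ++ eat); split.
    + rewrite prog_compile, Hp, flat_map_app; simpl; now rewrite <- !app_assoc.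
    + unfold preamble; rewrite !Forall_app; repeat split.
      * unfold header, nonstop; repeat constructor; simpl; tauto.
      * apply Forall_map, Forall_forall; intros r _; unfold nonstop; simpl; tauto.
      * apply Forall_flat_map, Forall_forall; auto.
      * apply Forall_flat_map; rewrite Forall_forall in Hfr; apply Forall_forall.
        intros ins Hins; apply Forall_app; split; [assumption|].
        repeat constructor; specialize (Hfr _ Hins); unfold nonstop in *.
        destruct ins; simpl in *; tauto.
      * assumption.
Qed.

(** Registers above [h] are left free: the simulating machine keeps guesses or scratch values there,
    and a single [c'] may track several [c] that differ only beyond the frontier. *)
Record tracks (h : nat) (c c' : config A) : Prop := {
  tracks_frontier : idx c' (frontier k) = h;
  tracks_above : idx c' (above k) = S h;
  tracks_pointer : forall j, 1 <= j <= J -> idx c' (pointer k j) = j;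
  tracks_idx : forall r, 1 <= r <= k -> idx c' r = idx c r;
  tracks_reg : forall i, i <= h -> reg c' i = reg c i
}.

(** The bounds [sim_idx_le] and [sim_J_le] place every [Z]-register accessible to the next
    non-oracle instruction, directly or through an index register, at or below the frontier. *)
Record sim (h : nat) (c c' : config A) : Prop := {
  sim_tracks : tracks h c c';
  sim_idx_le : forall r, 1 <= r <= k -> idx c r <= h;
  sim_J_le : J <= h;
  sim_label : 1 <= lab c <= length (prog M);
  sim_new_label : lab c' = new_label k J eat (lab c)
}.

(* The frontier has already been advanced to [S h] when the translated
   instruction runs, so it can only write below the frontier, and an oracle
   query is answered by the register just above it. *)
Lemma translate_step Q h c d c1 :
  tracks (S h) c d -> (forall r, 1 <= r <= k -> idx c r <= h) -> J <= h ->
  1 <= lab c <= length (prog M) -> lab d = new_label k J eat (lab c) + E ->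
  step_with M (reg d (S (S h))) c c1 ->
  exists d1, dstep Q M' d d1 /\ sim (S h) c1 d1 /\
    (forall i, h < i -> reg c1 i = reg c i) /\ (forall i, h < i -> reg d1 i = reg d i).
Proof using wfM J_bound.
  intros Ht Hidx HJ Hl Hld Hs.
  unfold step_with in Hs.
  destruct (nth_error (prog M) (lab c - 1)) as [ins|] eqn:Hn;
    [|unfold step in Hs; rewrite Hn in Hs; contradiction].
  assert (Hn' : nth_error (prog M') (lab d - 1) = Some (translate k J eat ins)).
  { rewrite <- (block_at (proj1 Hl) Hn E).
    - f_equal; rewrite Hld; pose proof (new_label_pos (lab c)); lia.
    - rewrite nth_error_app2, Nat.sub_diag; auto. }
  assert (HzJ : zreg_le J ins).
  { eapply Forall_forall in J_bound; eauto using nth_error_In. }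
  destruct (proj2 (proj2 wfM) _ _ Hn) as [Hok Hstop].
  assert (Hnext : ~ is_stop ins -> 1 <= S (lab c) <= length (prog M) /\
     S (lab d) = new_label k J eat (S (lab c))).
  { intros Hns; split.
    - assert (lab c - 1 <> length (prog M) - 1) by tauto; lia.
    - rewrite Hld; unfold new_label; fold E; destruct (lab c) as [|l]; [lia|].
      rewrite !Nat.sub_succ, !Nat.sub_0_r, Nat.mul_succ_r; generalize (S E * l); lia. }
  destruct Ht as [Tf Ta Tp Ti Tr].
  unfold step in Hs; rewrite Hn in Hs.
  assert (Hfun : forall m (args : Fin.t m -> nat), (forall t, args t <= J) ->
    (fun t => reg d (args t)) = (fun t => reg c (args t))).
  { intros m args Ha; apply functional_extensionality; intros t.
    apply Tr; specialize (Ha t); lia. }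
  unfold dstep, step; rewrite Hn'; destruct ins; simpl in *.
  - subst c1; eexists; split; [split; [reflexivity|discriminate]|].
    rewrite Hfun by tauto.
    split; [constructor; simpl; try tauto; try lia|].
    + constructor; simpl; auto. intros; apply fupd_agree; auto.
    + intros r Hr; specialize (Hidx r Hr); lia.
    + simpl; split; intros; apply fupd_neq; lia.
  - subst c1; eexists; split; [split; [reflexivity|discriminate]|].
    split; [constructor; simpl; try tauto; try lia|].
    + constructor; simpl; auto. intros; apply fupd_agree; auto.
    + intros r Hr; specialize (Hidx r Hr); lia.
    + simpl; split; intros; apply fupd_neq; lia.
  - destruct Hok as [Hj Hk].
    pose proof (Hidx _ Hj); pose proof (Hidx _ Hk).
    subst c1; eexists; split; [split; [reflexivity|discriminate]|].
    rewrite (Ti _ Hj), (Ti _ Hk), Tr by lia.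
    split; [constructor; simpl; try tauto; try lia|].
    + constructor; simpl; auto. intros; apply fupd_agree; auto.
    + intros r Hr; specialize (Hidx r Hr); lia.
    + simpl; split; intros; apply fupd_neq; lia.
  - destruct Hok as (_ & Hl1 & Hl2); rewrite Hfun by assumption.
    destruct Hs as [[Hr ->]|[Hr ->]]; (eexists; split; [split; [|discriminate]|]);
      [left; split; [exact Hr|reflexivity]| |right; split; [exact Hr|reflexivity]|];
      (split; [constructor; simpl; try tauto; try lia|]);
      try (constructor; simpl; auto); auto;
      intros r Hr'; specialize (Hidx r Hr'); lia.
  - destruct Hok as (Hj & Hk & Hl1 & Hl2); rewrite (Ti _ Hj), (Ti _ Hk).
    destruct Hs as [[Hr ->]|[Hr ->]]; (eexists; split; [split; [|discriminate]|]);
      [left; split; [exact Hr|reflexivity]| |right; split; [exact Hr|reflexivity]|];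
      (split; [constructor; simpl; try tauto; try lia|]);
      try (constructor; simpl; auto); auto;
      intros r Hr'; specialize (Hidx r Hr'); lia.
  - unfold ireg_ok in Hok; fold k in Hok.
    subst c1; eexists; split; [split; [reflexivity|discriminate]|].
    split; [constructor; simpl; try tauto; try lia|].
    + constructor; simpl; auto; unfold frontier, above, pointer in *; intros;
        try (rewrite fupd_neq by lia; auto).
      apply fupd_agree; auto.
    + intros r Hr; specialize (Hidx r Hr); unfold fupd; destruct (r =? j); lia.
    + simpl; auto.
  - unfold ireg_ok in Hok; fold k in Hok.
    subst c1; eexists; split; [split; [reflexivity|discriminate]|].
    split; [constructor; simpl; try tauto; try lia|].
    + constructor; simpl; auto; unfold frontier, above, pointer in *; intros;
        try (rewrite fupd_neq by lia; auto).
      apply fupd_agree; auto.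
    (* An index register bounded by [h] may become [S h]; the advance just made restores the
       bound. *)
    + intros r Hr; pose proof (Hidx r Hr); pose proof (Hidx j Hok).
      unfold fupd; destruct (r =? j); lia.
    + simpl; auto.
  - contradiction.
  - unfold zreg_ok in Hok.
    subst c1; eexists; split; [split; [reflexivity|discriminate]|].
    rewrite Ta, Tp by lia.
    split; [constructor; simpl; try tauto; try lia|].
    + constructor; simpl; auto. intros; apply fupd_agree; auto.
    + intros r Hr; specialize (Hidx r Hr); lia.
    + simpl; split; intros; apply fupd_neq; lia.
Qed.

(** Induction on the gap [g] between the frontier register and the input length; the loop leaves to
    label 6, the first one after the header. *)
Lemma header_loop Q g : forall c,
  lab c = 2 -> idx c 1 = idx c (frontier k) + g -> idx c (above k) = S (idx c (frontier k)) ->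
  exists m d, nsteps (dstep Q M') m c d /\ lab d = 6 /\ reg d = reg c /\
    idx d (frontier k) = idx c 1 /\ idx d (above k) = S (idx c 1) /\
    forall r, r <> frontier k -> r <> above k -> idx d r = idx c r.
Proof using wfM.
  assert (Hk : 1 <= k) by apply wfM.
  assert (Hfa : frontier k <> above k /\ 1 <> frontier k /\ 1 <> above k)
    by (unfold frontier, above; lia).
  induction g as [|g IH]; intros c Hl Hg Ha.
  - exists 1, (mkConfig 6 (idx c) (reg c)); split.
    + apply nsteps_one; unfold dstep, step.
      replace (lab c - 1) with 1 by lia; rewrite (header_at 1 eq_refl : nth_error (prog M') 1 = _); split; [left; split; [lia|reflexivity]|discriminate].
    + repeat split; simpl; auto; lia.
  - pose (c1 := mkConfig 3 (idx c) (reg c)).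
    pose (c2 := inc_eff (frontier k) c1).
    pose (c3 := inc_eff (above k) c2).
    pose (c4 := mkConfig 2 (idx c3) (reg c3)).
    assert (H4f : idx c4 (frontier k) = S (idx c (frontier k))).
    { simpl; rewrite fupd_neq by tauto; apply fupd_eq. }
    assert (H4a : idx c4 (above k) = S (idx c (above k))).
    { simpl; rewrite fupd_eq, fupd_neq; intuition. }
    assert (H4 : forall r, r <> frontier k -> r <> above k -> idx c4 r = idx c r).
    { intros r H1 H2; simpl; rewrite !fupd_neq; auto. }
    destruct (IH c4) as (m & d & Hd & Hld & Hrd & Hfd & Had & Hod).
    + reflexivity.
    + rewrite H4f, H4; [lia|tauto|tauto].
    + lia.
    + rewrite H4 in Hfd, Had by tauto.
      exists (4 + m), d; split; [|repeat split; auto].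
      * simpl; apply nsteps_S with c1; [|apply nsteps_S with c2;
          [|apply nsteps_S with c3; [|apply nsteps_S with c4; [|exact Hd]]]].
        -- unfold dstep, step; replace (lab c - 1) with 1 by lia; rewrite (header_at 1 eq_refl : nth_error (prog M') 1 = _).
           split; [right; split; [lia|reflexivity]|discriminate].
        -- apply inc_dstep, (header_at 2 eq_refl).
        -- apply inc_dstep, (header_at 3 eq_refl).
        -- unfold dstep, step; simpl lab.
           rewrite (header_at 4 eq_refl : nth_error (prog M') (5 - 1) = _).
           split; [left; split; reflexivity|discriminate].
      * intros r H1 H2; rewrite Hod, H4; auto.
Qed.

(** So far only index registers have changed, and only the first [length x] registers are compared.
    Hence the same [d] tracks the initial configurations for all guesses [zs], which need not be the
    guesses [ys] of the simulating machine. *)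
Lemma init_tracks Q (x ys : list (U A)) a :
  x <> [] -> exists m d,
    nsteps (dstep Q M') m (init_config x ys a) d /\ lab d = start + 1 /\
    reg d = reg (init_config x ys a) /\
    forall zs, tracks (length x) (init_config x zs a) d.
Proof using wfM.
  intros Hx; assert (Hn : 1 <= length x) by (destruct x; simpl; [congruence|lia]).
  assert (Hk : 1 <= k) by apply wfM.
  pose (c := init_config x ys a).
  pose (c1 := inc_eff (above k) c).
  assert (H1 : dstep Q M' c c1) by apply inc_dstep, (header_at 0 eq_refl).
  assert (Hca : idx c1 (above k) = 2).
  { simpl; rewrite fupd_eq; unfold above; destruct (Nat.eqb_spec (S (S k)) 1); lia. }
  assert (Hc1 : forall r, r <> above k -> idx c1 r = if r =? 1 then length x else 1).
  { intros r Hr; apply fupd_neq, Hr. }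
  assert (Hcf : idx c1 (frontier k) = 1).
  { rewrite Hc1; unfold above, frontier; [destruct (Nat.eqb_spec (S k) 1)|]; lia. }
  assert (Hcn : idx c1 1 = length x).
  { rewrite Hc1; unfold above; [reflexivity|lia]. }
  destruct (@header_loop Q (length x - 1) c1) as (m & d & Hd & Hld & Hrd & Hfd & Had & Hod);
    [reflexivity|lia|lia|].
  destruct (@incs_dsteps A Q M' (pointer_incs k J) d) as (d' & Hd' & Hld' & Hrd' & Hid').
  - lia.
  - rewrite Hld; apply (proj2 (code_at_app (header k) _ (le_n 1) header_at)).
  - exists (S m + length (pointer_incs k J)), d'; split; [|split; [|split]].
    + eapply nsteps_trans; [eapply nsteps_S|]; eauto.
    + rewrite Hld', Hld; unfold start; lia.
    + now rewrite Hrd', Hrd.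
    + intros zs; constructor; [| |intros r Hr|intros r Hr|].
      1-4: rewrite Hid', count_pointer_incs.
      * rewrite Hfd, Hcn, (proj2 (Nat.ltb_ge _ _)) by (unfold above, frontier; lia); simpl; lia.
      * rewrite Had, Hcn, (proj2 (Nat.ltb_ge _ _)) by lia; simpl; lia.
      * unfold pointer; fold (above k).
        rewrite (proj2 (Nat.ltb_lt _ _)), (proj2 (Nat.leb_le _ _)) by lia; cbn [andb].
        rewrite Hod, Hc1 by (unfold above, frontier; lia).
        unfold above; destruct (Nat.eqb_spec (S (S k) + r) 1); lia.
      * rewrite Hod, Hc1, (proj2 (Nat.ltb_ge _ _)) by (unfold above, frontier; lia).
        simpl; lia.
      * intros i Hi; rewrite Hrd', Hrd; simpl; rewrite !app_nth1 by lia; reflexivity.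
Qed.

Lemma sim_start h c c' :
  tracks h c c' -> (forall r, 1 <= r <= k -> idx c r <= h) -> J <= h ->
  lab c = 1 -> lab c' = start + E * J + 1 -> sim h c c'.
Proof using wfM.
  clear J_bound.
  intros Ht Hi HJ Hl Hl'; constructor; trivial.
  - rewrite Hl; destruct wfM as (_ & Hne & _); destruct (prog M); simpl; [congruence|lia].
  - rewrite Hl, Hl'; unfold new_label; rewrite length_preamble; simpl; lia.
Qed.

Lemma sim_code h c c' :
  sim h c c' -> exists ins, nth_error (prog M) (lab c - 1) = Some ins /\
    code_at M' (lab c') (eat ++ [translate k J eat ins]).
Proof.
  intros Hs; destruct (nth_error (prog M) (lab c - 1)) as [ins|] eqn:Hn.
  - exists ins; split; [trivial|]; rewrite (sim_new_label Hs).
    apply block_at; [apply Hs|exact Hn].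
  - apply nth_error_None in Hn; pose proof (sim_label Hs); lia.
Qed.

Lemma sim_label_pos h c c' : sim h c c' -> 1 <= lab c'.
Proof. intros Hs; rewrite (sim_new_label Hs); apply new_label_pos. Qed.

Lemma sim_eat_at h c c' : sim h c c' -> code_at M' (lab c') eat.
Proof.
  intros Hs; destruct (sim_code Hs) as (ins & _ & Hc).
  apply code_at_app in Hc; [tauto|eapply sim_label_pos; eauto].
Qed.

(** The block of the stop instruction also begins with [eat], so the compiled machine stops only
    after one more advance. *)
Lemma halted_new_label : new_label k J eat (length (prog M)) + E = length (prog M').
Proof using wfM.
  clear J_bound.
  rewrite length_compile; unfold new_label; fold E.
  destruct wfM as (_ & Hne & _); destruct (prog M) as [|i p]; [congruence|].
  simpl length; rewrite Nat.sub_succ, Nat.sub_0_r, Nat.mul_succ_r.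
  generalize (S E * length p); lia.
Qed.

(** Recovers the simulated label from the simulating configuration alone. *)
Lemma new_label_inj l1 l2 :
  1 <= l1 -> 1 <= l2 -> new_label k J eat l1 = new_label k J eat l2 -> l1 = l2.
Proof.
  unfold new_label; intros H1 H2 H.
  assert (S (length eat) * (l1 - 1) = S (length eat) * (l2 - 1)) as He by lia.
  apply Nat.mul_cancel_l in He; lia.
Qed.

End Compile.

(** * Facts common to both directions *)

Lemma init_idx_le {A : structure} (x ys : list (U A)) a r :
  x <> [] -> idx (init_config x ys a) r <= length x.
Proof. destruct x; [congruence|]; simpl; destruct (r =? 1); lia. Qed.

(** The range includes position [length x] itself, so the frontier register holds the fill value
    from the start and can serve as its source. *)
Lemma init_reg_last {A : structure} (x : list (U A)) a i :
  x <> [] -> length x <= i -> reg (init_config x [] (last x a)) i = last x a.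
Proof.
  intros Hx Hi; simpl; rewrite app_nil_r.
  destruct (exists_last Hx) as (z & b & ->).
  rewrite length_app in Hi; simpl in Hi; rewrite last_last.
  rewrite app_nth2 by lia; now destruct (pred i - length z) as [|[|]].
Qed.

Lemma step_with_step {A : structure} (M : machine A) y c c1 :
  step_with M y c c1 -> step (Uinf A) M c c1.
Proof.
  unfold step_with; destruct (nth_error _ _) as [ins|] eqn:Hn; trivial.
  destruct ins; trivial; intros ->; unfold step; rewrite Hn; left.
  exists y; split; [|reflexivity].
  exists []; unfold Uinf; intros H; apply app_eq_nil in H as [_ H]; discriminate.
Qed.

(** The looping branch of a query is impossible, since any element answers it. Here [reg c 0] merely
    supplies some element of the universe. *)
Lemma step_step_with {A : structure} (M : machine A) c c1 :
  step (Uinf A) M c c1 -> exists y, step_with M y c c1.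
Proof.
  intros Hs; unfold step_with; destruct (nth_error _ _) as [ins|] eqn:Hn.
  - destruct ins; try (exists (reg c 0); exact Hs).
    unfold step in Hs; rewrite Hn in Hs.
    destruct Hs as [(y & _ & ->)|[Hno _]]; [eauto|].
    exfalso; apply (Hno (reg c 0)); exists []; unfold Uinf; intros H.
    apply app_eq_nil in H as [_ H]; discriminate.
  - exists (reg c 0); exact Hs.
Qed.

Lemma step_with_no_oracle {A : structure} (M : machine A) Q y c c1 :
  no_oracle M -> (step_with M y c c1 <-> step Q M c c1).
Proof.
  unfold no_oracle, step_with, step; intros Ho.
  destruct (nth_error _ _) as [ins|] eqn:Hn; [|reflexivity].
  destruct ins; try reflexivity; now apply Ho in Hn.
Qed.

(** The effect shared by both versions of [eat], which differ in how the new frontier register gets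
    its value. *)
Lemma tracks_grow {A : structure} (M : machine A) J h c c' l' i' r' :
  tracks M J h c c' ->
  i' (frontier (nidx M)) = S h -> i' (above (nidx M)) = S (S h) ->
  (forall r, r <> frontier (nidx M) -> r <> above (nidx M) -> i' r = idx c' r) ->
  (forall i, i <= h -> r' i = reg c' i) -> r' (S h) = reg c (S h) ->
  tracks M J (S h) c (mkConfig l' i' r').
Proof.
  unfold frontier, above; intros [Tf Ta Tp Ti Tr] Hf Ha Hi Hr HS.
  constructor; simpl; unfold frontier, above, pointer in *; auto.
  - intros j Hj; rewrite Hi by lia; auto.
  - intros r Hr'; rewrite Hi by lia; auto.
  - intros i Hi'; destruct (Nat.eq_dec i (S h)) as [->|]; [exact HS|].
    rewrite Hr by lia; apply Tr; lia.
Qed.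

(** * From oracle machines to guessing machines *)

(* The register above the frontier, a guess of the input, is replaced by the
   content of the frontier register, which is always the last input entry:
   this is what the simulated machine finds beyond the frontier. *)
Definition eat_guess {A : structure} (k : nat) : list (instr A) :=
  [ICopy (above k) (frontier k); IIdxInc (frontier k); IIdxInc (above k)].

Lemma eat_guess_run {A : structure} (M M' : machine A) J Q h c c' :
  tracks M J h c c' -> 1 <= lab c' -> code_at M' (lab c') (eat_guess (nidx M)) ->
  reg c (S h) = reg c h ->
  exists d, nsteps (dstep Q M') 3 c' d /\ lab d = lab c' + 3 /\
    tracks M J (S h) c d /\ forall i, S h < i -> reg d i = reg c' i.
Proof.
  intros Ht Hl Hc Hch; unfold eat_guess in Hc.
  apply code_at_cons in Hc as [H1 Hc]; [|lia].
  apply code_at_cons in Hc as [H2 Hc]; [|lia].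
  apply code_at_cons in Hc as [H3 _]; [|lia].
  set (k := nidx M) in *.
  pose (c1 := copy_eff (above k) (frontier k) c').
  pose (c2 := inc_eff (frontier k) c1).
  pose (c3 := inc_eff (above k) c2).
  exists c3; split; [|split; [|split]].
  - apply nsteps_S with c1; [now apply copy_dstep|].
    apply nsteps_S with c2; [now apply inc_dstep|].
    apply nsteps_one; now apply inc_dstep.
  - simpl; lia.
  - pose proof (tracks_frontier Ht) as Tf; pose proof (tracks_above Ht) as Ta.
    fold k in Tf, Ta.
    apply (tracks_grow (c' := c')); trivial; fold k; simpl.
    + rewrite fupd_neq by (unfold frontier, above; lia); rewrite fupd_eq; auto.
    + rewrite fupd_eq, fupd_neq by (unfold frontier, above; lia); auto.
    + intros r Hr1 Hr2; rewrite !fupd_neq; auto.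
    + intros i Hi; rewrite fupd_neq; auto; lia.
    + rewrite Ta, Tf, fupd_eq, Hch; apply (tracks_reg Ht); lia.
  - intros i Hi; simpl; rewrite (tracks_above Ht : idx c' (above k) = _).
    apply fupd_neq; lia.
Qed.

Section OracleToGuess.
Variables (A : structure) (M : machine A) (J : nat).
Hypothesis wfM : wf_machine M.
Hypothesis J_bound : Forall (zreg_le J) (prog M).

Let k := nidx M.
Let eat := @eat_guess A k.
Let M' := compile M J eat.
Let Q' : list (U A) -> Prop := fun _ => False.

Lemma guess_machine_wf : wf_machine M'.
Proof using wfM J_bound.
  apply compile_wf; trivial; unfold eat, eat_guess.
  - rewrite !Forall_cons_iff; simpl; unfold ireg_ok, above, frontier; simpl nidx; fold k.
    intuition (auto; lia).
  - rewrite !Forall_cons_iff; unfold nonstop; simpl; intuition.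
Qed.

Lemma guess_machine_no_oracle : no_oracle M'.
Proof.
  intros n j H; apply nth_error_In in H; simpl in H; fold k in H.
  destruct H as [H|[H|[H|[H|[H|H]]]]]; try discriminate.
  rewrite !in_app_iff, !in_flat_map in H; destruct H as [[H|H]|H].
  - apply in_map_iff in H as (r & H & _); discriminate.
  - destruct H as (_ & _ & H); unfold eat, eat_guess in H; simpl in H.
    intuition discriminate.
  - destruct H as (ins & _ & H); unfold eat, eat_guess in H; simpl in H.
    destruct ins; simpl in H; intuition discriminate.
Qed.

(** Without guesses the simulated machine starts with the last input entry everywhere from position
    [length x] on, and its writes stay below the advancing frontier. This invariant justifies
    copying the frontier register one place up. *)
Definition constant_from (h : nat) (c : config A) : Prop :=
  forall i, h <= i -> reg c i = reg c h.

Lemma guess_preamble t (x ys : list (U A)) a :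
  t <= J -> x <> [] -> exists m d,
    nsteps (dstep Q' M') m (init_config x ys (last x a)) d /\
    lab d = 5 + length (pointer_incs k J) + 3 * t + 1 /\
    tracks M J (length x + t) (init_config x [] (last x a)) d /\
    forall i, length x + t < i -> reg d i = reg (init_config x ys (last x a)) i.
Proof using wfM.
  intros Ht Hx; induction t as [|t IH].
  - destruct (@init_tracks A M J eat wfM Q' x ys (last x a) Hx) as (m & d & Hd & Hl & Hr & Htr).
    exists m, d; rewrite Nat.mul_0_r, !Nat.add_0_r; split; [exact Hd|split; [exact Hl|]].
    split; [apply Htr|]; intros; now rewrite Hr.
  - destruct IH as (m & d & Hd & Hl & Htr & Hr); [lia|].
    destruct (@eat_guess_run A M M' J Q' _ _ _ Htr) as (d' & Hd' & Hl' & Htr' & Hr').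
    + lia.
    + rewrite Hl; apply (@preamble_eat_at A M J eat t); lia.
    + rewrite !init_reg_last by (trivial; lia); reflexivity.
    + exists (m + 3), d'; split; [eapply nsteps_trans; eauto|].
      replace (length x + S t) with (S (length x + t)) by lia.
      split; [lia|split; [exact Htr'|]].
      intros i Hi; rewrite Hr', Hr by lia; reflexivity.
Qed.

Lemma guess_start (x ys : list (U A)) a :
  x <> [] -> exists m d,
    nsteps (dstep Q' M') m (init_config x ys (last x a)) d /\
    sim M J eat (length x + J) (init_config x [] (last x a)) d /\
    constant_from (length x + J) (init_config x [] (last x a)) /\
    forall i, length x + J < i -> reg d i = reg (init_config x ys (last x a)) i.
Proof using wfM.
  intros Hx; destruct (@guess_preamble J x ys a) as (m & d & Hd & Hl & Ht & Hr); auto.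
  exists m, d; split; [exact Hd|split; [|split; [|exact Hr]]].
  - apply sim_start; auto; [|lia].
    intros r _; pose proof (@init_idx_le A x [] (last x a) r Hx); lia.
  - intros i Hi; rewrite !init_reg_last by (trivial; lia); reflexivity.
Qed.

Lemma guess_eat h c c' :
  sim M J eat h c c' -> constant_from h c -> exists d,
    nsteps (dstep Q' M') 3 c' d /\ lab d = lab c' + 3 /\
    tracks M J (S h) c d /\ forall i, S h < i -> reg d i = reg c' i.
Proof.
  intros Hs Hc; apply eat_guess_run.
  - apply Hs.
  - eapply sim_label_pos; eauto.
  - eapply sim_eat_at; eauto.
  - apply Hc; lia.
Qed.

Lemma guess_halts h c c' :
  sim M J eat h c c' -> constant_from h c -> halted M c ->
  exists d, nsteps (dstep Q' M') 3 c' d /\ halted M' d.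
Proof using wfM.
  intros Hs Hc Hh; destruct (guess_eat Hs Hc) as (d & Hd & Hl & _).
  exists d; split; [exact Hd|]; unfold halted in *.
  rewrite Hl, (sim_new_label Hs), Hh; apply (@halted_new_label A M J eat wfM).
Qed.

(** The advance erases the guess at [S h], so the answer is the one at [S (S h)]. The next advance
    erases that register in turn: each step consumes exactly one fresh guess. *)
Lemma guess_step h c c' c1 :
  sim M J eat h c c' -> constant_from h c ->
  step_with M (reg c' (S (S h))) c c1 ->
  exists c1', nsteps (dstep Q' M') 4 c' c1' /\ sim M J eat (S h) c1 c1' /\
    constant_from (S h) c1 /\ forall i, S h < i -> reg c1' i = reg c' i.
Proof using wfM J_bound.
  intros Hs Hc Hst; destruct (guess_eat Hs Hc) as (d & Hd & Hl & Ht & Hr).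
  destruct (@translate_step A M J eat wfM J_bound Q' h c d c1)
    as (c1' & Hd1 & Hs1 & Hr1 & Hr1'); auto; try apply Hs.
  - rewrite Hl, (sim_new_label Hs); reflexivity.
  - rewrite Hr by lia; exact Hst.
  - exists c1'; split; [|split; [|split]]; trivial.
    + apply (@nsteps_trans _ _ 3 1 c' d c1'); auto using nsteps_one.
    + intros i Hi; rewrite !Hr1, (Hc i), (Hc (S h)) by lia; reflexivity.
    + intros i Hi; rewrite Hr1', Hr by lia; reflexivity.
Qed.

(** The list [w] collects one answer per step, arbitrary where no query occurs. It is extracted from
    the run of [M] before [c'] is given, because all guesses must be present in the initial
    configuration. *)
Lemma guess_complete n c e :
  nsteps (step (Uinf A) M) n c e -> halted M e ->
  exists w, forall h c', sim M J eat h c c' -> constant_from h c ->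
    (forall t y, nth_error w t = Some y -> reg c' (S (S h) + t) = y) ->
    exists e' m, nsteps (step Q' M') m c' e' /\ halted M' e'.
Proof using wfM J_bound.
  induction 1 as [e|n c c1 e Hst _ IH]; intros He.
  - exists []; intros h c' Hs Hc _.
    destruct (guess_halts Hs Hc He) as (d & Hd & Hh); eauto using dsteps_steps.
  - destruct (IH He) as [w Hw]; destruct (step_step_with _ _ _ Hst) as [y Hy].
    exists (y :: w); intros h c' Hs Hc Htape.
    pose proof (Htape 0 y eq_refl) as H0; rewrite Nat.add_0_r in H0; rewrite <- H0 in Hy.
    destruct (guess_step _ Hs Hc Hy) as (c1' & Hst' & Hs1 & Hc1 & Hr1).
    destruct (Hw _ _ Hs1 Hc1) as (e' & m & Hm & He').
    + intros t z Hz; rewrite Hr1 by lia; rewrite <- (Htape (S t) z Hz); f_equal; lia.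
    + exists e', (4 + m); split; trivial.
      eapply nsteps_trans; eauto using dsteps_steps.
Qed.

(** Whatever the guesses are, they are legal answers. As long as [M] has not halted it can take a
    step answered by the next guess, and determinism forces the given run through its translation,
    using up four steps. The run is finite, so [M] halts. *)
Lemma guess_sound n : forall h c c' e,
  sim M J eat h c c' -> constant_from h c ->
  nsteps (step Q' M') n c' e -> halted M' e ->
  exists f, reach (Uinf A) M c f /\ halted M f.
Proof using wfM J_bound.
  induction n as [n IH] using lt_wf_ind; intros h c c' e Hs Hc Hn He.
  destruct (Nat.eq_dec (lab c) (length (prog M))) as [Hh|Hh].
  { exists c; split; [apply reach_refl|exact Hh]. }
  destruct (step_with_progress (reg c' (S (S h))) wfM (sim_label Hs) Hh) as [c1 Hst].
  destruct (guess_step _ Hs Hc Hst) as (c1' & Hst' & Hs1 & Hc1 & _).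
  destruct (dsteps_cut guess_machine_wf Hst' Hn He) as (n' & -> & Hn').
  destruct (IH n' ltac:(lia) _ _ _ _ Hs1 Hc1 Hn' He) as (f & Hf & Hhf).
  exists f; split; trivial; eapply reach_step; [eapply step_with_step|]; eauto.
Qed.

Lemma guess_halts_iff x : halts_det (Uinf A) M x <-> halts_ND M' x.
Proof using wfM J_bound.
  split.
  - intros (a & r & e & -> & Hr & He); apply reach_nsteps in Hr as [n Hn].
    destruct (guess_complete Hn He) as [w Hw].
    (* The padding covers the [J] guesses erased in the preamble and the one erased by the first
       block; [w] starts right above them. *)
    destruct (@guess_start (a :: r) (repeat a (S J) ++ w) a)
      as (m & d & Hd & Hs & Hc & Htape); [discriminate|].
    destruct (Hw _ _ Hs Hc) as (e' & m' & Hm' & He').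
    + intros t y Hy; rewrite Htape by lia; unfold init_config, reg.
      assert (t < length w) by (apply nth_error_Some; congruence).
      rewrite app_nth2, app_nth2; rewrite ?repeat_length; simpl length; try lia.
      replace (_ - _) with t by lia; now apply nth_error_nth.
    + exists a, r, (repeat a (S J) ++ w), e'; repeat split; trivial; [discriminate|].
      apply reach_nsteps; eexists; eapply nsteps_trans; eauto using dsteps_steps.
  - intros (a & r & ys & e & -> & _ & Hr & He); apply reach_nsteps in Hr as [n Hn].
    destruct (@guess_start (a :: r) ys a) as (m & d & Hd & Hs & Hc & _); [discriminate|].
    destruct (dsteps_cut guess_machine_wf Hd Hn He) as (n' & _ & Hn').
    destruct (guess_sound Hs Hc Hn' He) as (f & Hf & Hhf).
    exists a, r, f; auto.
Qed.

End OracleToGuess.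

(** * From guessing machines to oracle machines *)

(* An oracle answer is stored in the register above the frontier. Since
   [IOracle] writes to a fixed register, [Z_1] is saved one position further up
   meanwhile. *)
Definition eat_answer {A : structure} (k : nat) : list (instr A) :=
  [IIdxInc (frontier k); IIdxInc (above k); ICopy (above k) (pointer k 1);
   IOracle 1; ICopy (frontier k) (pointer k 1); ICopy (pointer k 1) (above k)].

(** The configurations [d y] depend only on [c'] and the answer [y]. The answers can therefore be
    read off a halting run first, and a configuration [c] containing them as guesses supplied
    afterwards. *)
Lemma eat_answer_run {A : structure} (M M' : machine A) J h c0 c' :
  wf_machine M' -> 1 <= J -> 1 <= h ->
  tracks M J h c0 c' -> 1 <= lab c' -> code_at M' (lab c') (eat_answer (nidx M)) ->
  exists d : U A -> config A,
    (forall y, nsteps (step (Uinf A) M') 6 c' (d y)) /\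
    (forall n e, nsteps (step (Uinf A) M') n c' e -> halted M' e ->
       exists y n', n = 6 + n' /\ nsteps (step (Uinf A) M') n' (d y) e) /\
    (forall y, lab (d y) = lab c' + 6) /\
    (forall c y, tracks M J h c c' -> reg c (S h) = y -> tracks M J (S h) c (d y)).
Proof.
  intros Hw HJ Hh Ht Hl Hc; unfold eat_answer in Hc.
  apply code_at_cons in Hc as [H1 Hc]; [|lia].
  apply code_at_cons in Hc as [H2 Hc]; [|lia].
  apply code_at_cons in Hc as [H3 Hc]; [|lia].
  apply code_at_cons in Hc as [H4 Hc]; [|lia].
  apply code_at_cons in Hc as [H5 Hc]; [|lia].
  apply code_at_cons in Hc as [H6 _]; [|lia].
  set (k := nidx M) in *.
  pose (c1 := inc_eff (frontier k) c').
  pose (c2 := inc_eff (above k) c1).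
  pose (c3 := copy_eff (above k) (pointer k 1) c2).
  pose (c4 := fun y => mkConfig (S (lab c3)) (idx c3) (fupd (reg c3) 1 y)).
  pose (c5 := fun y => copy_eff (frontier k) (pointer k 1) (c4 y)).
  pose (c6 := fun y => copy_eff (pointer k 1) (above k) (c5 y)).
  assert (P3 : nsteps (dstep (Uinf A) M') 3 c' c3).
  { apply nsteps_S with c1; [now apply inc_dstep|].
    apply nsteps_S with c2; [now apply inc_dstep|].
    apply nsteps_one; now apply copy_dstep. }
  assert (P4 : forall y, step (Uinf A) M' c3 (c4 y)).
  { intros y; apply (@step_with_step A M' y); unfold step_with.
    change (lab c3) with (S (S (S (lab c')))); now rewrite H4. }
  assert (P6 : forall y, nsteps (dstep (Uinf A) M') 2 (c4 y) (c6 y)).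
  { intros y; apply nsteps_S with (c5 y); [now apply copy_dstep|].
    apply nsteps_one; now apply copy_dstep. }
  exists c6; split; [|split; [|split]].
  - intros y; apply (@nsteps_trans _ _ 3 3 c' c3); [now apply dsteps_steps|].
    apply nsteps_S with (c4 y); [apply P4|now apply dsteps_steps].
  - intros n e Hn He.
    destruct (dsteps_cut Hw P3 Hn He) as (n3 & -> & Hn3).
    (* The answer [reg c' 0] only shows that [c3] has a successor, so the run does not end there;
       the actual answer [y] is obtained next. *)
    destruct (nsteps_head _ Hw (P4 (reg c' 0)) Hn3 He) as (c4' & n4 & -> & Hs & Hn4).
    destruct (step_step_with _ _ _ Hs) as [y Hy]; unfold step_with in Hy.
    change (lab c3) with (S (S (S (lab c')))) in Hy; rewrite H4 in Hy; subst c4'.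
    destruct (dsteps_cut Hw (P6 y) Hn4 He) as (n' & -> & Hn').
    exists y, n'; split; [lia|exact Hn'].
  - intros y; simpl; lia.
  - intros c y Htc Hy.
    pose proof (tracks_frontier Htc) as Tf; pose proof (tracks_above Htc) as Ta.
    pose proof (tracks_pointer Htc (conj (le_n 1) HJ)) as Tp.
    fold k in Tf, Ta, Tp.
    assert (If : idx c3 (frontier k) = S h).
    { simpl; rewrite fupd_neq by (unfold frontier, above; lia); rewrite fupd_eq; auto. }
    assert (Ia : idx c3 (above k) = S (S h)).
    { simpl; rewrite fupd_eq, fupd_neq by (unfold frontier, above; lia); auto. }
    assert (Ip : idx c3 (pointer k 1) = 1).
    { simpl; rewrite !fupd_neq by (unfold frontier, above, pointer; lia); auto. }
    assert (R3 : reg c3 = fupd (reg c') (S (S h)) (reg c' 1)).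
    { change (reg c3) with (fupd (reg c') (idx c3 (above k)) (reg c' (idx c3 (pointer k 1)))).
      now rewrite Ia, Ip. }
    assert (R5 : reg (c5 y) = fupd (fupd (reg c3) 1 y) (S h) y).
    { change (reg (c5 y)) with (fupd (fupd (reg c3) 1 y) (idx c3 (frontier k))
        (fupd (reg c3) 1 y (idx c3 (pointer k 1)))).
      now rewrite If, Ip, fupd_eq. }
    assert (R6 : reg (c6 y) = fupd (reg (c5 y)) 1 (reg c' 1)).
    { change (reg (c6 y)) with (fupd (reg (c5 y)) (idx c3 (pointer k 1))
        (reg (c5 y) (idx c3 (above k)))).
      rewrite Ip, Ia, R5, !fupd_neq, R3, fupd_eq by lia; reflexivity. }
    change (c6 y) with (mkConfig (lab (c6 y)) (idx c3) (reg (c6 y))).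
    apply (tracks_grow (c' := c')); trivial; fold k.
    + intros r Hr1 Hr2; simpl; rewrite !fupd_neq; auto.
    + intros i Hi; rewrite R6; destruct (Nat.eq_dec i 1) as [->|Hi1].
      * apply fupd_eq.
      * rewrite fupd_neq, R5, !fupd_neq, R3, fupd_neq by lia; reflexivity.
    (* From [1 <= h], restoring [Z_1] does not overwrite the answer stored at [S h]. *)
    + rewrite R6, fupd_neq, R5, fupd_eq by lia; auto.
Qed.

Section GuessToOracle.
Variables (A : structure) (M : machine A) (J : nat).
Hypothesis wfM : wf_machine M.
Hypothesis no_oracleM : no_oracle M.
Hypothesis J_pos : 1 <= J.
Hypothesis J_bound : Forall (zreg_le J) (prog M).

Let k := nidx M.
Let eat := @eat_answer A k.
Let M' := compile M J eat.
Let start := 5 + length (pointer_incs k J).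
Let Q : list (U A) -> Prop := fun _ => False.

Lemma answer_machine_wf : wf_machine M'.
Proof using wfM J_pos J_bound.
  apply compile_wf; trivial; unfold eat, eat_answer.
  - rewrite !Forall_cons_iff; simpl; unfold ireg_ok, zreg_ok, above, frontier, pointer;
      simpl nidx; fold k; intuition (auto; lia).
  - rewrite !Forall_cons_iff; unfold nonstop; simpl; intuition.
Qed.

Lemma answer_eat h c0 c' :
  1 <= h -> tracks M J h c0 c' -> 1 <= lab c' -> code_at M' (lab c') eat ->
  exists d : U A -> config A,
    (forall y, nsteps (step (Uinf A) M') 6 c' (d y)) /\
    (forall n e, nsteps (step (Uinf A) M') n c' e -> halted M' e ->
       exists y n', n = 6 + n' /\ nsteps (step (Uinf A) M') n' (d y) e) /\
    (forall y, lab (d y) = lab c' + 6) /\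
    (forall c y, tracks M J h c c' -> reg c (S h) = y -> tracks M J (S h) c (d y)).
Proof using wfM J_pos J_bound.
  intros; eapply eat_answer_run; eauto using answer_machine_wf.
Qed.

Lemma answer_step h c c' d c1 :
  sim M J eat h c c' -> tracks M J (S h) c d -> lab d = lab c' + 6 ->
  step Q M c c1 ->
  exists d1, dstep (Uinf A) M' d d1 /\ sim M J eat (S h) c1 d1 /\
    forall i, h < i -> reg c1 i = reg c i.
Proof using wfM J_bound no_oracleM.
  intros Hs Ht Hl Hst.
  destruct (@translate_step A M J eat wfM J_bound (Uinf A) h c d c1)
    as (d1 & Hd1 & Hs1 & Hr1 & _); eauto; try apply Hs.
  - rewrite Hl, (sim_new_label Hs); reflexivity.
  - apply (step_with_no_oracle Q); assumption.
Qed.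

Lemma answer_progress c :
  1 <= lab c <= length (prog M) -> ~ halted M c -> exists c1, step Q M c c1.
Proof using wfM no_oracleM.
  intros Hl Hh; destruct (step_with_progress (reg c 0) wfM Hl Hh) as [c1 H].
  exists c1; eapply step_with_no_oracle; eauto.
Qed.

(** Each query is answered by [reg c (S h)], the guess that becomes visible at the new frontier; the
    oracle permits every answer. *)
Lemma answer_complete n c e :
  nsteps (step Q M) n c e -> halted M e -> forall h c', 1 <= h -> sim M J eat h c c' ->
  exists e', reach (Uinf A) M' c' e' /\ halted M' e'.
Proof using wfM J_pos J_bound no_oracleM.
  induction 1 as [e|n c c1 e Hst _ IH]; intros He h c' Hh Hs.
  all: destruct (answer_eat Hh (sim_tracks Hs) (sim_label_pos Hs) (sim_eat_at Hs))
    as (d & Hd & _ & Hl & Ht).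
  (* The query before the stop instruction may receive any answer. *)
  - exists (d (reg e 0)); split; [apply reach_nsteps; eauto|].
    unfold halted in *; rewrite Hl, (sim_new_label Hs), He.
    apply (@halted_new_label A M J eat wfM).
  - destruct (@answer_step h c c' (d (reg c (S h))) c1) as (d1 & Hd1 & Hs1 & _); auto.
    { apply Ht; [apply Hs|reflexivity]. }
    destruct (IH He (S h) d1 ltac:(lia) Hs1) as (e' & Hr & He').
    exists e'; split; trivial.
    apply reach_nsteps in Hr as [m Hm]; apply reach_nsteps; eexists.
    eapply nsteps_trans; [apply Hd|]; eapply nsteps_S; eauto using dstep_step.
Qed.

Definition holds_tape (h : nat) (w : list (U A)) (c : config A) : Prop :=
  forall t y, nth_error w t = Some y -> reg c (S h + t) = y.

Definition with_reg (c : config A) (i : nat) (y : U A) : config A :=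
  mkConfig (lab c) (idx c) (fupd (reg c) i y).

(** Position [S h] lies beyond the frontier, so a witness configuration can be adapted to any
    answer. *)
Lemma tracks_with_reg h c c' y :
  tracks M J h c c' -> tracks M J h (with_reg c (S h) y) c'.
Proof.
  clear J_pos; intros [Tf Ta Tp Ti Tr]; constructor; simpl; auto.
  intros i Hi; rewrite fupd_neq by lia; auto.
Qed.

Lemma sim_with_reg h c c' y :
  sim M J eat h c c' -> sim M J eat h (with_reg c (S h) y) c'.
Proof.
  intros [T Hi HJ Hl Hl']; constructor; simpl; auto using tracks_with_reg.
Qed.

(* The guesses [w] are read off the halting computation of the oracle machine
   before the guessing configuration [c] is known; [c0] only witnesses that
   [c'] is well formed. *)
Lemma answer_sound n : forall h c0 c' e,
  1 <= h -> sim M J eat h c0 c' -> nsteps (step (Uinf A) M') n c' e -> halted M' e ->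
  exists w, forall c, sim M J eat h c c' -> holds_tape h w c ->
    exists f, reach Q M c f /\ halted M f.
Proof using wfM J_pos J_bound no_oracleM.
  induction n as [n IH] using lt_wf_ind; intros h c0 c' e Hh Hs0 Hn He.
  (* All configurations simulated by [c'] share one label, so whether they have halted is known
     before [c] is chosen. *)
  assert (Hlab : forall c, sim M J eat h c c' -> lab c = lab c0).
  { intros c Hs; apply (@new_label_inj A M J eat); try apply Hs; try apply Hs0.
    now rewrite <- (sim_new_label Hs), <- (sim_new_label Hs0). }
  destruct (Nat.eq_dec (lab c0) (length (prog M))) as [Hf|Hf].
  { exists []; intros c Hs _; exists c; split; [apply reach_refl|].
    unfold halted; now rewrite (Hlab c Hs). }
  destruct (answer_eat Hh (sim_tracks Hs0) (sim_label_pos Hs0) (sim_eat_at Hs0))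
    as (d & _ & Hcut & Hl & Ht).
  destruct (Hcut _ _ Hn He) as (y & n' & -> & Hn').
  assert (Hnext : forall c, sim M J eat h c c' -> reg c (S h) = y ->
    exists c1 d1, step Q M c c1 /\ dstep (Uinf A) M' (d y) d1 /\
      sim M J eat (S h) c1 d1 /\ forall i, h < i -> reg c1 i = reg c i).
  { intros c Hs Hy.
    destruct (@answer_progress c (sim_label Hs)) as [c1 Hst].
    { unfold halted; now rewrite (Hlab c Hs). }
    destruct (@answer_step h c c' (d y) c1) as (d1 & Hd1 & Hs1 & Hr1); auto.
    { apply Ht; [apply Hs|exact Hy]. }
    exists c1, d1; auto. }
  (* Writing [y] into [c0] yields a witness for the induction hypothesis while [c] is still
     unknown. *)
  destruct (Hnext _ (sim_with_reg y Hs0)) as (c01 & d1 & _ & Hd1 & Hs01 & _).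
  { apply fupd_eq. }
  destruct (dsteps_cut answer_machine_wf (nsteps_one _ _ _ Hd1) Hn' He) as (n1 & -> & Hn1).
  destruct (IH n1 ltac:(lia) (S h) c01 d1 e ltac:(lia) Hs01 Hn1 He) as [w Hw].
  exists (y :: w); intros c Hs Htape.
  destruct (Hnext c Hs) as (c1 & d1' & Hst & Hd1' & Hs1 & Hr1).
  { rewrite <- (Htape 0 y eq_refl); f_equal; lia. }
  (* Both successors of [d y] coincide, so [c1] is simulated by the very configuration from which
     [w] was extracted. *)
  rewrite <- (dstep_det _ Hd1 (dstep_step Hd1')) in Hs1.
  destruct (Hw c1 Hs1) as (f & Hf' & Hhf).
  { intros t z Hz; rewrite Hr1 by lia; rewrite <- (Htape (S t) z Hz); f_equal; lia. }
  exists f; split; trivial; eapply reach_step; eauto.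
Qed.

Lemma preamble_label t (c' : config A) : t < J -> lab c' = start + 6 * t + 1 ->
  1 <= lab c' /\ code_at M' (lab c') eat.
Proof.
  clear J_pos; intros Ht Hl; rewrite Hl; split; [lia|].
  apply (@preamble_eat_at A M J eat t Ht).
Qed.

Lemma answer_preamble_complete s : forall t n c c',
  t + s = J -> 1 <= n -> tracks M J (n + t) c c' -> lab c' = start + 6 * t + 1 ->
  exists d, reach (Uinf A) M' c' d /\ tracks M J (n + J) c d /\ lab d = start + 6 * J + 1.
Proof using wfM J_pos J_bound.
  induction s as [|s IH]; intros t n c c' Hts Hn Htr Hl.
  - rewrite Nat.add_0_r in Hts; subst t; exists c'; split; [apply reach_refl|auto].
  - destruct (@preamble_label t c') as [Hpos Hcode]; trivial; [lia|].
    destruct (@answer_eat (n + t) c c' ltac:(lia) Htr Hpos Hcode) as (d & Hd & _ & Hld & Ht).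
    destruct (IH (S t) n c (d (reg c (S (n + t)))) ltac:(lia) Hn) as (f & Hf & Hrest); trivial.
    + rewrite Nat.add_succ_r; apply Ht; auto.
    + rewrite Hld; lia.
    + exists f; split; trivial.
      apply reach_nsteps in Hf as [m Hm]; apply reach_nsteps.
      eexists; eapply nsteps_trans; [apply Hd|exact Hm].
Qed.

(** With [s] advances of the preamble left, the answers they receive are prepended to the guesses
    from [answer_sound]; again the list is fixed before [c]. *)
Lemma answer_preamble_sound s : forall t h c0 c' m e,
  t + s = J -> 1 <= h -> tracks M J (h + t) c0 c' -> lab c0 = 1 ->
  (forall r, 1 <= r <= k -> idx c0 r <= h) -> lab c' = start + 6 * t + 1 ->
  nsteps (step (Uinf A) M') m c' e -> halted M' e ->
  exists w, forall c, tracks M J (h + t) c c' -> lab c = 1 ->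
    (forall r, 1 <= r <= k -> idx c r <= h) -> holds_tape (h + t) w c ->
    exists f, reach Q M c f /\ halted M f.
Proof using wfM J_pos J_bound no_oracleM.
  induction s as [|s IH]; intros t h c0 c' m e Hts Hh Htr0 Hl0 Hi0 Hl' Hm He.
  - rewrite Nat.add_0_r in Hts; subst t.
    assert (Hsim : forall c, tracks M J (h + J) c c' -> lab c = 1 ->
      (forall r, 1 <= r <= k -> idx c r <= h) -> sim M J eat (h + J) c c').
    { intros c Htr Hl Hi; apply sim_start; trivial; [|lia].
      intros r Hr; specialize (Hi r Hr); lia. }
    destruct (@answer_sound m (h + J) c0 c' e ltac:(lia)) as [w Hw]; auto.
    exists w; auto.
  - destruct (@preamble_label t c') as [Hpos Hcode]; trivial; [lia|].
    destruct (@answer_eat (h + t) c0 c' ltac:(lia) Htr0 Hpos Hcode)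
      as (d & _ & Hcut & Hld & Ht).
    destruct (Hcut _ _ Hm He) as (y & m' & -> & Hm').
    destruct (IH (S t) h (with_reg c0 (S (h + t)) y) (d y) m' e) as [w Hw]; auto; try lia.
    + rewrite Nat.add_succ_r; apply Ht; auto using tracks_with_reg; apply fupd_eq.
    + rewrite Hld; lia.
    + exists (y :: w); intros c Htr Hl Hi Htape; apply (Hw c); trivial.
      * rewrite Nat.add_succ_r; apply Ht; trivial.
        rewrite <- (Htape 0 y eq_refl); f_equal; lia.
      * intros i z Hz; rewrite <- (Htape (S i) z Hz); f_equal; lia.
Qed.

Lemma answer_halts_iff x : halts_ND M x <-> halts_det (Uinf A) M' x.
Proof using wfM J_pos J_bound no_oracleM.
  assert (Hstart : forall a r, exists m d,
    nsteps (dstep (Uinf A) M') m (init_config (a :: r) [] (last (a :: r) a)) d /\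
    lab d = start + 6 * 0 + 1 /\
    forall zs, tracks M J (length (a :: r) + 0) (init_config (a :: r) zs (last (a :: r) a)) d).
  { intros a r.
    destruct (@init_tracks A M J eat wfM (Uinf A) (a :: r) [] (last (a :: r) a))
      as (m & d & Hd & Hl & _ & Ht); [discriminate|].
    exists m, d; split; [exact Hd|split; [|intros zs; rewrite Nat.add_0_r; apply Ht]].
    rewrite Hl; unfold start; fold k; lia. }
  split.
  - intros (a & r & ys & e & -> & _ & Hr & He); apply reach_nsteps in Hr as [n Hn].
    destruct (Hstart a r) as (m & d & Hd & Hl & Ht).
    destruct (@answer_preamble_complete J 0 (length (a :: r))
      (init_config (a :: r) ys (last (a :: r) a)) d) as (d' & Hd' & Ht' & Hl'); auto;
      [simpl; lia|].
    destruct (answer_complete Hn He (h := length (a :: r) + J) (c' := d')) as (e' & Hr' & He').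
    + simpl; lia.
    + apply sim_start; trivial; [|lia].
      intros j _; pose proof (@init_idx_le A (a :: r) ys (last (a :: r) a) j); simpl in *.
      destruct (j =? 1); lia.
    + exists a, r, e'; split; [reflexivity|split; [|exact He']].
      apply reach_nsteps in Hr' as [m1 Hm1]; apply reach_nsteps in Hd' as [m2 Hm2].
      apply reach_nsteps; eexists; eapply nsteps_trans; [apply dsteps_steps, Hd|].
      eapply nsteps_trans; eauto.
  - intros (a & r & e & -> & Hr & He); apply reach_nsteps in Hr as [n Hn].
    destruct (Hstart a r) as (m & d & Hd & Hl & Ht).
    destruct (dsteps_cut answer_machine_wf Hd Hn He) as (n' & _ & Hn').
    assert (Hi : forall ys j, 1 <= j <= k ->
      idx (init_config (a :: r) ys (last (a :: r) a)) j <= length (a :: r)).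
    { intros ys j _; apply init_idx_le; discriminate. }
    destruct (@answer_preamble_sound J 0 (length (a :: r))
      (init_config (a :: r) [] (last (a :: r) a)) d n' e) as [w Hw]; auto; [simpl; lia|].
    (* The final [a] makes the guess list nonempty even if [w] is empty. *)
    destruct (Hw (init_config (a :: r) (w ++ [a]) (last (a :: r) a))) as (f & Hf & Hhf); auto.
    + intros t y Hy; unfold init_config, reg.
      assert (t < length w) by (apply nth_error_Some; congruence).
      rewrite app_nth2, app_nth1 by lia.
      replace (_ - _) with t by lia; now apply nth_error_nth.
    + exists a, r, (w ++ [a]), f; repeat split; trivial.
      intros H; apply app_eq_nil in H as [_ H]; discriminate.
Qed.

End GuessToOracle.

Theorem mainTheorem2 (A : structure) (P : list (U A) -> Prop) :
  SDEC_nu A (Uinf A) P <-> SDEC_ND A P.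
Proof.
  split; intros (M & wfM & H); destruct (zreg_bounded (prog M)) as (J & HJ & HB).
  - exists (compile M J (eat_guess (nidx M))).
    split; [now apply guess_machine_wf|split; [apply guess_machine_no_oracle|]].
    intros x; rewrite H; now apply guess_halts_iff.
  - destruct H as [Ho H]; exists (compile M J (eat_answer (nidx M))).
    split; [now apply answer_machine_wf|].
    intros x; rewrite H; now apply answer_halts_iff.
Qed.
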